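(* For every integer $l \ge 2$, the double domination numbers of the fractal cubic networks satisfy $\gamma_{\times 2}(FCN(l)) = 4\,\bigl(\gamma_{\times 2}(FCN(l-1)) - 1\bigr)$.
   Context: Fractal cubic network: for an integer $l\ge 0$, $FCN(l)$ is the finite simple graph whose vertices are all binary strings of length $2l+2$, defined recursively as follows. $FCN(0)$ is the 4-cycle with vertices $00, 01, 11, 10$ in this cyclic order. For $l\ge 1$, $FCN(l)$ is obtained from the disjoint union of the four copies $ab\,\Vert\,FCN(l-1)$, $a,b\in\{0,1\}$ (each vertex string of $FCN(l-1)$ is prefixed by $ab$, adjacency inside a copy being that of $FCN(l-1)$), by adding the four edges $\{00w,10w\}$, $\{10w,11w\}$, $\{11w,01w\}$, $\{01w,00w\}$, where $w=10(01)^{l-1}$ is the string $10$ followed by $l-1$ repetitions of $01$. A double dominating set of a graph $\Gamma$ is a set $D\subseteq V(\Gamma)$ such that $|N[v]\cap D|\ge 2$ for every $v\in V(\Gamma)$, where $N[v]$ is the closed neighborhood of $v$; $\gamma_{\times 2}(\Gamma)$ is the minimum size of a double dominating set. *)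

(* Defs.v *)
From mathcomp Require Import all_boot.

Set Implicit Arguments.
Unset Strict Implicit.
Unset Printing Implicit Defensive.

Record sgraph := SGraph {
  vertex : finType;
  adj : rel vertex;
  adj_sym : symmetric adj;
  adj_irrefl : irreflexive adj
}.

Definition closed_nbhd (G : sgraph) (v : vertex G) : {set vertex G} :=
  [set u | (u == v) || adj v u].

Definition double_dominating (G : sgraph) (D : {set vertex G}) : bool :=
  [forall v : vertex G, 2 <= #|closed_nbhd v :&: D|].

(* A graph has a double dominating set iff it has no isolated vertex, iff
   [set: vertex G] is one; otherwise the value is the default #|vertex G|.
   The graphs FCN l always have one, see double_dominating_FCN_setT. *)
Definition double_domination_number (G : sgraph) : nat :=
  #|[arg min_(D < [set: vertex G] | double_dominating D) #|D|]|.

Definition cycle_adj (T : eqType) (c : seq T) : rel T :=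
  fun u v => (u \in c) && ((v == next c u) || (u == next c v)).

(* Binary strings are sequences of booleans, 0 being false and 1 being true. *)
Definition b00 : seq bool := [:: false; false].
Definition b01 : seq bool := [:: false; true].
Definition b10 : seq bool := [:: true; false].
Definition b11 : seq bool := [:: true; true].

(* The string 10 (01)^k; the edges added to form FCN(l) use k = l - 1. *)
Definition fcn_w (k : nat) : seq bool := b10 ++ flatten (nseq k b01).

Fixpoint fcn_adj (l : nat) (u v : seq bool) : bool :=
  if l is k.+1 then
    (take 2 u == take 2 v) && fcn_adj k (drop 2 u) (drop 2 v)
    || cycle_adj [seq ab ++ fcn_w k | ab <- [:: b00; b10; b11; b01]] u v
  else cycle_adj [:: b00; b01; b11; b10] u v.

Lemma cycle_adj_sym (T : eqType) (c : seq T) : symmetric (cycle_adj c).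
Proof.
move=> u v; rewrite /cycle_adj orbC.
case: eqP => [->|_] /=; first by rewrite mem_next andbT.
by case: eqP => [->|_] /=; rewrite ?mem_next ?andbF.
Qed.

Lemma fcn_adj_sym (l : nat) : symmetric (fcn_adj l).
Proof.
elim: l => [|k IHk] u v /=; first exact: cycle_adj_sym.
by rewrite eq_sym IHk cycle_adj_sym.
Qed.

Lemma fcn_adj_irrefl (l : nat) : irreflexive (fcn_adj l).
Proof.
elim: l => [|k IHk] u /=; apply/negbTE; rewrite ?IHk ?andbF /= /cycle_adj orbb;
  apply/negP => /andP[]; rewrite !inE.
  by case/or4P => /eqP ->.
by case/or4P => /eqP ->; rewrite /= !eqseq_cons /= ?eqxx.
Qed.

Definition fcn_tuple_adj (l : nat) : rel ((2 * l + 2).-tuple bool) :=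
  fun u v => fcn_adj l u v.

Lemma fcn_tuple_adj_sym (l : nat) : symmetric (@fcn_tuple_adj l).
Proof. by move=> u v; apply: fcn_adj_sym. Qed.

Lemma fcn_tuple_adj_irrefl (l : nat) : irreflexive (@fcn_tuple_adj l).
Proof. by move=> u; apply: fcn_adj_irrefl. Qed.

Definition FCN (l : nat) : sgraph :=
  SGraph (@fcn_tuple_adj_sym l) (@fcn_tuple_adj_irrefl l).

Lemma fcn_adj_neighbor (l : nat) (u : seq bool) :
  size u = 2 * l + 2 -> exists2 v, size v = 2 * l + 2 & fcn_adj l u v.
Proof.
elim: l u => [|k IHk] u.
  by case: u => [|[] [|[] []]] // _;
    [exists b10 | exists b00 | exists b11 | exists b01].
rewrite mulnS -addnA; case: u => [|a [|b u]] // [] /IHk[v sv uv].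
by exists [:: a, b & v]; rewrite /= ?sv // !take0 !drop0 eqxx uv.
Qed.

Lemma double_dominating_FCN_setT (l : nat) :
  double_dominating [set: vertex (FCN l)].
Proof.
apply/forallP => /= u; rewrite setIT.
have [v /eqP sv uv] := fcn_adj_neighbor (size_tuple u).
have: adj (u : vertex (FCN l)) (Tuple sv) by [].
move: (Tuple sv : vertex (FCN l)) => {sv uv}v uv.
have neq_uv : u != v.
  by apply: contraTneq uv => <-; rewrite (adj_irrefl (u : vertex (FCN l))).
have: 1 < #|[set u; v]| by rewrite cards2 neq_uv.
move/leq_trans; apply.
by apply/subset_leq_card/subsetP => x; rewrite !inE => /orP[] /eqP->;
  rewrite ?eqxx // uv orbT.
Qed.

(* Main.v *)
(** Write a vertex as [p ++ c] with [size c = 2]; for fixed [p] these four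
    vertices form a 4-cycle. The vertices [p ++ 00] and [p ++ 11] never have a
    neighbour outside their 4-cycle, [p ++ 10] has one as soon as [l > 0], and
    [p ++ 01] has one only for certain [p], called bridged. The constraints at
    the vertices without outside neighbours force a double dominating set to
    contain at least 2 vertices of a bridged 4-cycle and at least 3 of any other
    one. Both bounds are attained simultaneously by taking [01] and [10] in
    every 4-cycle, plus [00] in those that are not bridged. Passing from [l - 1]
    to [l >= 2] quadruples the 4-cycles and makes exactly one more of them
    bridged in each copy. *)

Require Import Defs.
From mathcomp Require Import all_boot.
From mathcomp Require Import zify.

(** * Sums over strings of fixed length *)

Lemma sum_tuple0 (T : finType) (F : seq T -> nat) :
  \sum_(t : 0.-tuple T) F t = F [::].
Proof.
by rewrite (big_pred1 [tuple]) // => t; apply/esym/eqP/tuple0.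
Qed.

Lemma sum_tupleS (T : finType) n (F : seq T -> nat) :
  \sum_(t : n.+1.-tuple T) F t = \sum_x \sum_(t : n.-tuple T) F (x :: t).
Proof.
rewrite pair_big /=.
rewrite (reindex (fun xt : T * n.-tuple T => [tuple of xt.1 :: xt.2])) //=.
exists (fun t => (thead t, [tuple of behead t])) => [[x t] _|t _] /=.
  by congr (_, _); apply/val_inj.
by rewrite -tuple_eta.
Qed.

Lemma sum_tuple_cat (T : finType) m n (F : seq T -> nat) :
  \sum_(t : (m + n).-tuple T) F t =
  \sum_(p : m.-tuple T) \sum_(c : n.-tuple T) F (p ++ c).
Proof.
elim: m F => [|m IHm] F.
  by rewrite (sum_tuple0 _ (fun p => \sum_(c : n.-tuple T) F (p ++ c))).
rewrite (sum_tupleS _ _ (fun p => \sum_(c : n.-tuple T) F (p ++ c))).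
by rewrite addSn sum_tupleS; apply: eq_bigr => x _; apply: (IHm (fun t => F (x :: t))).
Qed.

Lemma sum_tuple2 (F : seq bool -> nat) :
  \sum_(c : 2.-tuple bool) F c = F b00 + F b01 + F b10 + F b11.
Proof.
have E x : \sum_(t : 1.-tuple bool) F (x :: t) =
    F [:: x; true] + F [:: x; false].
  rewrite (sum_tupleS _ _ (fun t => F (x :: t))) big_bool /=.
  by rewrite !(sum_tuple0 _ (fun t => F [:: x, _ & t])).
by rewrite sum_tupleS big_bool /= !E /b00 /b01 /b10 /b11; lia.
Qed.

Lemma sum_tuple_eq (T : finType) n (w : seq T) :
  size w = n -> \sum_(t : n.-tuple T) (val t == w) = 1.
Proof.
move=> /eqP sw; rewrite -(big_mkcond (fun t => val t == w) (fun _ => 1)) /=.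
by rewrite (big_pred1 (Tuple sw)).
Qed.

(** * The strings [fcn_w k] and bridged 4-cycles *)

Lemma fcn_wS k : fcn_w k.+1 = fcn_w k ++ b01.
Proof. by rewrite /fcn_w -addn1 nseqD flatten_cat catA. Qed.

Lemma size_fcn_w k : size (fcn_w k) = 2 * k + 2.
Proof. by elim: k => // k IHk; rewrite fcn_wS size_cat IHk /=; lia. Qed.

Lemma fcn_w_cat k q c :
  size c = 2 -> q ++ c = fcn_w k -> c = b10 \/ c = b01.
Proof.
move=> sc; case: k => [|k] E.
  have sq : size q = 0 by move: (congr1 size E); rewrite size_cat sc /=; lia.
  by rewrite (size0nil sq) in E; left.
have sq : size q = size (fcn_w k).
  by move: (congr1 size E); rewrite fcn_wS !size_cat sc /=; lia.
by move/eqP: E; rewrite fcn_wS eqseq_cat // => /andP[_ /eqP]; right.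
Qed.

(** Whether some edge added at a level [<= l] is incident to [p ++ 01]. *)
Fixpoint bridged (l : nat) (p : seq bool) : bool :=
  if l is k.+1 then bridged k (drop 2 p) || (drop 2 p ++ b01 == fcn_w k)
  else false.

Lemma bridged_cons2 l a b p :
  bridged l.+1 [:: a, b & p] = bridged l p || (p ++ b01 == fcn_w l).
Proof. by rewrite /= drop0. Qed.

(** Dropping pairs and appending 01 keeps the string a power of 01, which starts with 0, whereas
    every [fcn_w] starts with 1. *)
Lemma bridged_nseq k j : bridged k (flatten (nseq j b01)) = false.
Proof.
elim: k j => // k IHk [|j] /=; first by rewrite (IHk 0).
by rewrite drop0 IHk; case: j.
Qed.

(** Ensures that the 4-cycle that becomes bridged at a new level was not bridged before, so it is
    counted once. *)
Lemma bridged_fcn_w l k : bridged l (fcn_w k) = false.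
Proof. by case: l => // l /=; rewrite drop0 bridged_nseq; case: k. Qed.

(** * Neighbours inside and outside a 4-cycle *)

Lemma fcn_adj_block l p c c' : size p = 2 * l ->
  cycle_adj [:: b00; b01; b11; b10] c c' -> fcn_adj l (p ++ c) (p ++ c').
Proof.
elim: l p => [|l IHl] p; first by move/size0nil->.
case: p => [|a [|b p]]; rewrite ?mulnS // => -[sp] cc'.
by rewrite /= !take0 !drop0 eqxx IHl.
Qed.

(** An added edge ends at a vertex whose tail is some [fcn_w], hence whose last two letters are 10
    or 01; in the second case [p] is bridged. *)
Lemma fcn_adj_inner l p c v :
    size p = 2 * l -> size c = 2 -> c != b10 -> ~~ bridged l p || (c != b01) ->
  fcn_adj l (p ++ c) v ->
  exists2 c', v = p ++ c' & cycle_adj [:: b00; b01; b11; b10] c c'.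
Proof.
move=> + sc c10; elim: l p v => [|l IHl] p v.
  by move/size0nil-> => _ cv; exists v.
case: p => [|a [|b p]]; rewrite ?mulnS // => -[sp] /=.
rewrite !take0 !drop0 => brp /orP[/andP[/eqP tv]|].
  case/IHl => // [|c' dv cc'].
    by apply: contraTT brp; rewrite !negb_or !negbK => /andP[-> ->].
  by exists c' => //; rewrite -(cat_take_drop 2 v) -tv dv.
case/andP => uw _; exfalso.
have E : p ++ c = fcn_w l.
  by move: uw; rewrite !inE => /or4P[] /eqP[_ _ ->].
case: (fcn_w_cat _ _ _ sc E) => c_eq; first by rewrite c_eq in c10.
by rewrite c_eq in E brp; rewrite E eqxx orbT in brp.
Qed.

Lemma fcn_adj_bridge k a b : exists a' b',
  fcn_adj k.+1 (a :: b :: fcn_w k) (a' :: b' :: fcn_w k).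
Proof.
(* The map sending [a], [b] to [b], [~~ a] rotates the cycle 00, 01, 11, 10 by one step. *)
exists b, (~~ a); apply/orP; right; rewrite /cycle_adj !inE /=.
by case: a b => [] []; rewrite !eqseq_cons /= !eqxx.
Qed.

Lemma fcn_adj_cons2 l a b u v :
  fcn_adj l u v -> fcn_adj l.+1 [:: a, b & u] [:: a, b & v].
Proof. by move=> uv; rewrite /= !take0 !drop0 eqxx uv. Qed.

(** The edges added at level 1 have [w] = 10, so they reach the vertex 10 of every 4-cycle, and
    later levels keep them. The neighbour has the same last two letters, so it lies in the optimal
    set as well. *)
Lemma fcn_adj_b10 l p : 0 < l -> size p = 2 * l ->
  exists2 q, size q = 2 * l & fcn_adj l (p ++ b10) (q ++ b10).
Proof.
case: l => // l _; elim: l p => [|l IHl] [|a [|b p]] //; rewrite mulnS => -[sp].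
  have [a' [b' E]] := fcn_adj_bridge 0 a b.
  by exists [:: a'; b'] => //; rewrite (size0nil sp).
have [q sq E] := IHl p sp.
by exists [:: a, b & q]; [rewrite /= sq | exact: fcn_adj_cons2].
Qed.

Lemma fcn_adj_b01 l p : size p = 2 * l -> bridged l p ->
  exists2 q, size q = 2 * l & fcn_adj l (p ++ b01) (q ++ b01).
Proof.
elim: l p => // l IHl p; rewrite mulnS; case: p => [|a [|b p]] // [sp].
rewrite bridged_cons2 => /orP[brp|/eqP pw].
  have [q sq E] := IHl p sp brp.
  by exists [:: a, b & q]; [rewrite /= sq | exact: fcn_adj_cons2].
have [a' [b' E]] := fcn_adj_bridge l a b.
by exists [:: a', b' & p]; [rewrite /= sp | rewrite !cat_cons pw].
Qed.

(** * The optimal set and its size *)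

Definition optimal_dom (l : nat) (u : seq bool) : bool :=
  let p := take (2 * l) u in let c := drop (2 * l) u in
  [|| c == b01, c == b10 | (c == b00) && ~~ bridged l p].

Lemma optimal_dom_cat l p c : size p = 2 * l ->
  optimal_dom l (p ++ c) =
  [|| c == b01, c == b10 | (c == b00) && ~~ bridged l p].
Proof. by move=> sp; rewrite /optimal_dom take_size_cat ?drop_size_cat. Qed.

Definition block_cost (l : nat) : nat :=
  \sum_(p : (2 * l).-tuple bool) (3 - bridged l p).

(** For [0 < l] the string [fcn_w l] ends in 01, so in each of the four copies exactly one 4-cycle
    becomes bridged and the cost drops by 1. For [l = 0] it is 10, and none does. *)
Lemma block_costS l : 0 < l -> block_cost l.+1 = 4 * (block_cost l - 1).
Proof.
case: l => // l _.
have E : \sum_(q : (2 * l.+1).-tuple bool)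
     (3 - (bridged l.+1 q || (q ++ b01 == fcn_w l.+1))) = block_cost l.+1 - 1.
  have sw : size (fcn_w l) = 2 * l.+1 by rewrite size_fcn_w; lia.
  (* Writing 1 as the sum of the indicator of [fcn_w l] reduces the equality to a termwise one. *)
  apply/eqP; rewrite -(addnK 1 (\sum_q _)) -[X in _ + X](sum_tuple_eq _ _ _ sw).
  rewrite -big_split; apply/eqP; congr (_ - _); apply: eq_bigr => q _.
  rewrite [in q ++ _ == _]fcn_wS eqseq_cat ?size_tuple ?sw // andbT.
  case: eqP => [->|_]; last by rewrite orbF /= addn0.
  by rewrite (bridged_fcn_w l.+1).
rewrite /block_cost mulnS.
rewrite (sum_tuple_cat _ _ _ (fun p => 3 - bridged l.+2 p)).
rewrite (sum_tuple2 (fun c =>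
  \sum_(q : (2 * l.+1).-tuple bool) (3 - bridged l.+2 (c ++ q)))).
have B a b :
    \sum_(q : (2 * l.+1).-tuple bool) (3 - bridged l.+2 ([:: a; b] ++ q)) =
    block_cost l.+1 - 1.
  by rewrite -E; apply: eq_bigr => q _; rewrite !cat_cons cat0s bridged_cons2.
by rewrite /b00 /b01 /b10 /b11 !B -/(block_cost _); lia.
Qed.

Lemma optimal_dom_weight l :
  \sum_(u : (2 * l + 2).-tuple bool) optimal_dom l u = block_cost l.
Proof.
rewrite (sum_tuple_cat _ _ _ (optimal_dom l)); apply: eq_bigr => p _.
rewrite (sum_tuple2 (fun c => optimal_dom l (p ++ c))).
by rewrite !optimal_dom_cat ?size_tuple //=; case: bridged.
Qed.

Lemma optimal_dom_double l :
  double_dominating ([set u | optimal_dom l (val u)] : {set vertex (FCN l)}).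
Proof.
pose N u x := (x == u) || fcn_adj l u x.
suff dom u : size u = 2 * l + 2 -> exists x y,
    [/\ size x = size u, size y = size u, x != y,
        optimal_dom l x && N u x & optimal_dom l y && N u y].
  apply/forallP => /= u; apply/card_gt1P.
  have [x [y [/eqP sx /eqP sy xy /andP[Dx Nx] /andP[Dy Ny]]]] :=
    dom u (size_tuple u).
  rewrite size_tuple in sx sy; exists (Tuple sx), (Tuple sy).
  by rewrite !inE /= -!val_eqE /=; split=> //; apply/andP.
move=> su.
have [sp sc] : size (take (2 * l) u) = 2 * l /\ size (drop (2 * l) u) = 2.
  by rewrite size_drop size_takel su; lia.
rewrite -(cat_take_drop (2 * l) u) {su}.
move: (take _ u) (drop _ u) sp sc => p c sp sc.
(* Two ways to be dominated twice: by two vertices of the same 4-cycle ([inner]), or by the vertex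
   itself and a neighbour in another 4-cycle ([outer]). *)
have inner c1 c2 : size c1 = 2 -> size c2 = 2 -> c1 != c2 ->
    optimal_dom l (p ++ c1) &&
      ((c1 == c) || cycle_adj [:: b00; b01; b11; b10] c c1) ->
    optimal_dom l (p ++ c2) &&
      ((c2 == c) || cycle_adj [:: b00; b01; b11; b10] c c2) ->
  exists x y, [/\ size x = size (p ++ c), size y = size (p ++ c), x != y,
    optimal_dom l x && N (p ++ c) x & optimal_dom l y && N (p ++ c) y].
  move=> sc1 sc2 c12 /andP[D1 N1] /andP[D2 N2]; exists (p ++ c1), (p ++ c2).
  rewrite !size_cat sc sc1 sc2 D1 D2 eqseq_cat // eqxx c12 /N; split=> //=.
    by case/orP: N1 => [/eqP->|/(fcn_adj_block _ _ _ _ sp)->]; rewrite ?eqxx ?orbT.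
  by case/orP: N2 => [/eqP->|/(fcn_adj_block _ _ _ _ sp)->]; rewrite ?eqxx ?orbT.
have outer q : size q = 2 * l -> optimal_dom l (p ++ c) -> optimal_dom l (q ++ c) ->
    fcn_adj l (p ++ c) (q ++ c) ->
  exists x y, [/\ size x = size (p ++ c), size y = size (p ++ c), x != y,
    optimal_dom l x && N (p ++ c) x & optimal_dom l y && N (p ++ c) y].
  move=> sq Dp Dq pq; exists (p ++ c), (q ++ c).
  rewrite !size_cat sp sq Dp Dq /N eqxx pq orbT; split=> //.
  by apply: contraTneq pq => <-; rewrite fcn_adj_irrefl.
have [brp|nbrp] := boolP (bridged l p).
  case: c sc inner outer => [|[] [|[] []]] // _ inner outer.
  - by apply: (inner b01 b10); rewrite // optimal_dom_cat.
  - have lgt0 : 0 < l by case: (l) brp.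
    have [q sq pq] := fcn_adj_b10 l p lgt0 sp.
    by apply: (outer q); rewrite ?optimal_dom_cat.
  - have [q sq pq] := fcn_adj_b01 l p sp brp.
    by apply: (outer q); rewrite ?optimal_dom_cat.
  - by apply: (inner b01 b10); rewrite // optimal_dom_cat.
case: c sc inner {outer} => [|[] [|[] []]] // _ inner.
- by apply: (inner b01 b10); rewrite // optimal_dom_cat.
- by apply: (inner b10 b00); rewrite // optimal_dom_cat ?nbrp.
- by apply: (inner b01 b00); rewrite // optimal_dom_cat ?nbrp.
- by apply: (inner b01 b10); rewrite // optimal_dom_cat.
Qed.

Lemma block_cost_le l (D : {set vertex (FCN l)}) :
  double_dominating D -> block_cost l <= #|D|.
Proof.
move/forallP => /= domD.
(* Membership in [D] is extended to all strings, so that the sum can be split into 4-cycles. *)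
pose F u := u \in [seq val t | t <- enum D].
have FE t : F (val t) = (t \in D).
  by rewrite /F mem_map ?mem_enum //; exact: val_inj.
have -> : #|D| = \sum_(u : (2 * l + 2).-tuple bool) F u.
  rewrite -sum1_card big_mkcond /=; apply: eq_bigr => u _.
  by rewrite FE; case: (_ \in _).
rewrite (sum_tuple_cat _ _ _ F); apply: leq_sum => p _.
rewrite (sum_tuple2 (fun c => F (p ++ c))).
(* Where no neighbour lies outside, the domination condition is a count within the 4-cycle. *)
have dom2 c : size c = 2 -> c != b10 -> ~~ bridged l p || (c != b01) ->
    1 < count (fun c' => ((c' == c) || cycle_adj [:: b00; b01; b11; b10] c c')
                         && F (p ++ c')) [:: b00; b01; b10; b11].
  move=> sc c10 brp.
  have su : size (p ++ c) == 2 * l + 2 by rewrite size_cat size_tuple sc.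
  have near (x : vertex (FCN l)) :
      x \in closed_nbhd (Tuple su : vertex (FCN l)) :&: D ->
      exists2 c', val x = p ++ c' & c' \in [seq c' <- [:: b00; b01; b10; b11] |
        ((c' == c) || cycle_adj [:: b00; b01; b11; b10] c c') && F (p ++ c')].
    rewrite !inE => /andP[+ Dx]; rewrite -FE in Dx.
    case/orP=> [/eqP xu|/(fcn_adj_inner _ _ _ _ (size_tuple p) sc c10 brp)[c' xc' cc']].
      exists c; first by rewrite xu.
      rewrite mem_filter eqxx; rewrite xu in Dx; rewrite [F _]Dx.
      by case: c sc {c10 brp su x xu Dx} => [|[] [|[] []]].
    exists c' => //; rewrite mem_filter cc' orbT -xc' Dx /=.
    move: cc'; rewrite cycle_adj_sym => /andP[+ _].
    by rewrite !inE => /or4P[] ->; rewrite ?orbT.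
  have /card_gt1P[x [y [/near[c1 xc1 c1in] /near[c2 yc2 c2in] xy]]] :=
    domD (Tuple su).
  rewrite -size_filter; apply: (@uniq_leq_size _ [:: c1; c2]).
    rewrite /= inE andbT; apply: contraNneq xy => c12.
    by rewrite -val_eqE xc1 yc2 c12.
  by move=> z; rewrite !inE => /orP[] /eqP->.
(* The condition at 00 alone gives 2 vertices. If there are only 2, the conditions at 00 and 11
   force them to be 01 and 10; then 01 is dominated only by itself within the 4-cycle, which is
   excluded when [p] is not bridged. *)
have d00 := dom2 b00 erefl erefl (orbT _).
have d11 := dom2 b11 erefl erefl (orbT _).
move: d00 d11 (dom2 b01 erefl erefl); rewrite orbF /=.
case: bridged => /=.
  by case: (F _); case: (F _); case: (F _); case: (F _).
by case: (F _); case: (F _); case: (F _); case: (F _) => //= _ _ /(_ isT).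
Qed.

Lemma double_domination_number_FCN l :
  double_domination_number (FCN l) = block_cost l.
Proof.
rewrite /double_domination_number.
case: arg_minnP => [|D domD minD]; first exact: double_dominating_FCN_setT.
apply/eqP; rewrite eqn_leq block_cost_le // andbT.
apply: leq_trans (minD _ (optimal_dom_double l)) _.
rewrite -optimal_dom_weight -sum1_card big_mkcond /=.
by apply/eq_leq/eq_bigr => u _; rewrite inE; case: optimal_dom.
Qed.

Theorem theorem25 (l : nat) (hl : 2 <= l) :
  double_domination_number (FCN l) =
  4 * (double_domination_number (FCN (l - 1)) - 1).
Proof.
rewrite !double_domination_number_FCN; case: l hl => [|[|l]] // _.
by rewrite (subn1 l.+2) block_costS.
Qed.
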